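(* For all integers $p\ge 1$ and $d\ge 1$, no graph with pathwidth at most $p$ contains a distance-$d$ semi-ladder of order $$ (2d+3)(p+1)!\,[(2d+3)(d+2)]^{p+1}. $$
   Context: All graphs are finite, undirected and simple; $\mathrm{dist}$ is the shortest-path distance. For integers $d,\ell\ge 1$, $2\ell$ pairwise distinct vertices $a_1,\dots,a_\ell,b_1,\dots,b_\ell$ of a graph form a distance-$d$ semi-ladder of order $\ell$ if $\mathrm{dist}(b_i,a_j)\le d$ for all $1\le i<j\le \ell$, and $\mathrm{dist}(b_i,a_i)>d$ for every $i\in[1,\ell]$. A path decomposition of $G$ is a sequence of vertex subsets (bags) such that every edge has both endpoints in some bag and each vertex appears in a contiguous set of bags; its width is the maximum bag size minus one; the pathwidth is the minimum width of a path decomposition. *)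

(* Defs.v *)
From mathcomp Require Import all_boot.
From mathcomp Require Import boolp.

Set Implicit Arguments.
Unset Strict Implicit.
Unset Printing Implicit Defensive.

Definition walk (T : finType) (e : rel T) (n : nat) (u v : T) : bool :=
  [exists p : n.-tuple T, path e u p && (last u p == v)].

Lemma connect_walk (T : finType) (e : rel T) (u v : T) :
  connect e u v -> exists n, walk e n u v.
Proof.
case/connectP=> p up ->; exists (size p).
by apply/existsP; exists (in_tuple p); rewrite up /=.
Qed.

(* [None] is the infinite distance between different components. *)
Definition dist (T : finType) (e : rel T) (u v : T) : option nat :=
  if @idP (connect e u v) is ReflectT uv then Some (ex_minn (connect_walk uv))
  else None.

Definition at_most (x : option nat) (d : nat) : bool :=
  if x is Some n then n <= d else false.

(* The indices run over 0, ..., l - 1 instead of 1, ..., l. *)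
Definition semi_ladder (T : finType) (e : rel T) (d l : nat)
    (a b : 'I_l -> T) : Prop :=
  [/\ injective a, injective b & forall i j, a i <> b j] /\
  (forall i j : 'I_l, i < j -> at_most (dist e (b i) (a j)) d) /\
  (forall i : 'I_l, ~~ at_most (dist e (b i) (a i)) d).

Definition contains_semi_ladder (T : finType) (e : rel T) (d l : nat) : Prop :=
  exists a b : 'I_l -> T, semi_ladder e d a b.

(* As usual, every vertex, even isolated, has to occur in some bag. *)
Definition path_decomposition (T : finType) (e : rel T) (B : seq {set T}) :
    Prop :=
  [/\ forall v, exists2 X, X \in B & v \in X,
      forall u v, e u v -> exists2 X, X \in B & (u \in X) && (v \in X)
    & forall v i j k, i <= j <= k -> k < size B ->
        v \in nth set0 B i -> v \in nth set0 B k -> v \in nth set0 B j].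

(* The truncated predecessor makes the width 0 instead of -1 when all bags are
   empty, which is possible only for the graph without vertices. *)
Definition width (T : finType) (B : seq {set T}) : nat :=
  (\max_(X <- B) #|X|).-1.

Lemma path_decomposition_exists (T : finType) (e : rel T) :
  exists w, `[< exists2 B, path_decomposition e B & width B = w >].
Proof.
exists (width [:: [set: T]]); apply/asboolP; exists [:: [set: T]] => //; split.
- by move=> v; exists [set: T]; rewrite inE.
- by move=> u v _; exists [set: T]; rewrite !inE.
- move=> v i j [|k] /andP[_]; last by rewrite ltnS.
  by rewrite leqn0 => /eqP-> _ _.
Qed.

Definition pathwidth (T : finType) (e : rel T) : nat :=
  ex_minn (path_decomposition_exists e).

(* Main.v *)
Require Import Defs.
From mathcomp Require Import all_boot zify.

Set Implicit Arguments.
Unset Strict Implicit.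
Unset Printing Implicit Defensive.

(** Label each vertex [x] of a bag containing [a i] by the distance from [x] to
    [a i], capped at [d + 1]. By a labelled version of the sunflower lemma, the
    assumed order yields [2 d + 3] indices whose bags are disjoint outside a
    core [S] on which their labels agree. Let [i0] be the least of these
    indices. A path of length at most [d] from [b i0] to another [a j] avoids
    [S], since it could be diverted at a core vertex to [a i0]. Two such paths,
    to the leftmost and to the rightmost of the [a j], together have at most
    [2 d + 1] vertices but meet all of the [2 d + 2] other bags outside [S]. *)

Lemma card_bigcup_leq (I T : finType) (D : {set I}) (F : I -> {set T}) (c : nat) :
  (forall i, i \in D -> #|F i| <= c) -> #|\bigcup_(i in D) F i| <= #|D| * c.
Proof.
move=> Fc; rewrite -sum_nat_const.
apply: (@leq_trans (\sum_(i in D) #|F i|)); last exact: leq_sum.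
elim/big_ind2: _ => [|A m B n Am Bn|//]; first by rewrite cards0.
by rewrite cardsU (leq_trans (leq_subr _ _)) ?leq_add.
Qed.

(* [S] is the part of the core already fixed in the induction on [k]. *)
Lemma labelled_sunflower (I T L : finType) (A : I -> {set T})
    (f : I -> T -> L) (m k : nat) (S : {set T}) (D : {set I}) :
  0 < #|L| -> 0 < m ->
  (forall i, i \in D -> #|A i :\: S| <= k) ->
  {in D &, forall i j, {in S, f i =1 f j}} ->
  m * k`! * (m * #|L|) ^ k <= #|D| ->
  exists (J : {set I}) (S' : {set T}), [/\ J \subset D, m <= #|J|,
    {in J &, forall i j, i != j -> A i :&: A j \subset S'} &
    {in J &, forall i j, {in S', f i =1 f j}}].
Proof.
move=> L0 m0; elim: k S D => [|k IH] S D Ak fS Dm.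
  exists D, S; split=> //; first by rewrite fact0 expn0 !muln1 in Dm.
  move=> i j iD _ _; apply: subset_trans (subsetIl _ _) _.
  by rewrite -setD_eq0 -cards_eq0 -leqn0 Ak.
(* Either a maximal [J] with the sets [A j] pairwise disjoint outside [S] has [m] members, or every
   other [A i] meets one of these sets outside [S]. *)
pose disj (J : {set I}) := (J \subset D) &&
  [forall i in J, forall j in J, (i != j) ==> (A i :&: A j \subset S)].
have disj0 : disj set0.
  by rewrite /disj sub0set; apply/forall_inP=> i; rewrite inE.
have [J maxJ _] := maxset_exists disj0.
have /andP[JD /forall_inP Jdisj] := maxsetp maxJ.
have {}Jdisj : {in J &, forall i j, i != j -> A i :&: A j \subset S}.
  by move=> i j /Jdisj/forall_inP Ji /Ji /implyP.
case: (leqP m #|J|) => [mJ | Jm].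
  exists J, S; split=> // i j iJ jJ; apply: fS; exact: (subsetP JD).
pose U := \bigcup_(j in J) (A j :\: S).
have cardU : #|U| <= #|J| * k.+1.
  by apply: card_bigcup_leq => i iJ; rewrite Ak ?(subsetP JD).
pose C (uc : T * L) := [set i in D | (uc.1 \in A i) && (f i uc.1 == uc.2)].
have coverD : D \subset J :|: \bigcup_(uc in setX U [set: L]) C uc.
  apply/subsetP=> i iD; rewrite inE; case: (boolP (i \in J)) => //= iJ.
  have [/existsP[j /andP[jJ Aij]] | meets] :=
      boolP [exists j in J, ~~ (A i :&: A j \subset S)].
    have /subsetPn[u] := Aij; rewrite inE => /andP[ui uj] uS.
    apply/bigcupP; exists (u, f i u); last by rewrite inE iD ui /=.
    by rewrite !inE andbT; apply/bigcupP; exists j => //; rewrite inE uS.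
  (* Otherwise [i] could be added to the maximal family [J]. *)
  case/negP: iJ; rewrite -(maxsetsup maxJ _ (subsetUr [set i] J)) ?setU11 //.
  have {}meets j : j \in J -> A i :&: A j \subset S.
    move=> jJ; apply: contraR meets => Aij.
    by apply/existsP; exists j; rewrite jJ.
  apply/andP; split; first by rewrite subUset sub1set iD.
  apply/forall_inP=> x; rewrite !inE => xJ.
  apply/forall_inP=> y; rewrite !inE => yJ; apply/implyP.
  case/orP: xJ => [/eqP->|xJ]; case/orP: yJ => [/eqP->|yJ].
  - by rewrite eqxx.
  - by move=> _; apply: meets.
  - by move=> _; rewrite setIC; apply: meets.
  - exact: Jdisj.
(* If some class [C (u, c)] is large enough for the induction, [u] joins the core: all members carry
   the label [c] at [u], and each [A i :\: S] loses [u]. *)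
case: (boolP [exists uc in setX U [set: L],
                m * k`! * (m * #|L|) ^ k <= #|C uc|]) => [|small].
  case/existsP=> -[u c] /andP[]; rewrite inE /= => /andP[/bigcupP[j jJ] uj _].
  move: uj; rewrite inE => /andP[uS _] Cuc.
  have CD : C (u, c) \subset D by apply/subsetP=> i; rewrite inE => /andP[].
  have [i iC|i i' iC iC' x|//|J' [S' [J'C ? ? ?]]] := IH (u |: S) (C (u, c)).
  - rewrite -ltnS; apply: leq_trans (Ak i (subsetP CD _ iC)).
    apply: proper_card; apply/properP; split.
      by apply: setDS; apply: subsetUr.
    by exists u; rewrite !inE ?eqxx //= uS; move: iC; rewrite inE => /and3P[].
  - rewrite in_setU1 => /predU1P[->|xS].
      by move: iC iC'; rewrite !inE /= => /and3P[_ _ /eqP->] /and3P[_ _ /eqP->].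
    by apply: fS => //; apply: (subsetP CD).
  - by exists J', S'; split=> //; apply: subset_trans CD.
(* Now every class has at most [g] members, so [|D| <= |J| + |J| (k+1) |L| g]. As [|J| < m] and
   [m (k+1) |L| g <= |D|], this forces [(k+1) |L| g <= |J| < m <= g], which is absurd. *)
set g := m * k`! * (m * #|L|) ^ k in small.
have classes : #|\bigcup_(uc in setX U [set: L]) C uc| <= #|U| * #|L| * g.
  rewrite -[#|L|]cardsT -cardsX; apply: card_bigcup_leq => uc ucU.
  rewrite leqNgt; apply: contra small => /ltnW gC.
  by apply/existsP; exists uc; rewrite ucU.
have mg : m <= g.
  by rewrite /g -mulnA leq_pmulr // muln_gt0 fact_gt0 expn_gt0 muln_gt0 m0 L0.
have DUJ : #|D| <= #|J| + #|U| * #|L| * g.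
  apply: leq_trans (subset_leq_card coverD) _.
  by rewrite cardsU (leq_trans (leq_subr _ _)) // leq_add2l.
have step : m * k.+1`! * (m * #|L|) ^ k.+1 = m * k.+1 * #|L| * g.
  by rewrite factS expnS /g; nia.
have Ug : #|U| * #|L| * g <= #|J| * k.+1 * #|L| * g by rewrite !leq_mul2r cardU !orbT.
have Jg : #|J|.+1 * k.+1 * #|L| * g <= m * k.+1 * #|L| * g.
  by rewrite -!mulnA leq_mul2r Jm orbT.
have gL : g <= k.+1 * #|L| * g by rewrite leq_pmull // muln_gt0 L0.
have : #|J|.+1 * k.+1 * #|L| * g = #|J| * k.+1 * #|L| * g + k.+1 * #|L| * g.
  by rewrite -!mulnA mulSn addnC.
rewrite step in Dm; lia.
Qed.

Lemma at_most_distP (T : finType) (e : rel T) (u v : T) (n : nat) :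
  reflect (exists p, [/\ path e u p, last u p = v & size p <= n])
          (at_most (dist e u v) n).
Proof.
rewrite /dist; case: {-}_ / idP => [uv|nuv] /=; last first.
  by constructor=> -[p [up pv _]]; apply: nuv; apply/connectP; exists p.
case: ex_minnP => k walk_k kmin.
apply: (iffP idP) => [kn | [q [uq qv qn]]].
  have /existsP[p /andP[up /eqP pv]] := walk_k.
  by exists p; rewrite size_tuple.
apply: leq_trans (kmin _ _) qn; apply/existsP.
by exists (in_tuple q); rewrite uq qv eqxx.
Qed.

(** All distances above [d], infinite ones included, share the label [d + 1]. *)
Definition capped_dist (T : finType) (e : rel T) (d : nat) (u v : T) : 'I_d.+2 :=
  inord (if dist e u v is Some n then minn n d.+1 else d.+1).

Lemma at_most_capped_dist (T : finType) (e : rel T) (d : nat) (u v : T) (n : nat) :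
  n <= d -> at_most (dist e u v) n = (capped_dist e d u v <= n).
Proof.
move=> nd; rewrite /capped_dist.
by case: (dist e u v) => [k|] /=; rewrite inordK; lia.
Qed.

(** The first edge lies in some bag [k]. If [k <= t], induction applies to the rest of the path,
    starting in bag [k]; otherwise [u] is in bags [s] and [k], hence in bag [t] between them. *)
Lemma path_meets_bag (T : finType) (e : rel T) (B : seq {set T})
    (u : T) (q : seq T) (s t r : nat) :
  path_decomposition e B -> path e u q ->
  s <= t <= r -> r < size B ->
  u \in nth set0 B s -> last u q \in nth set0 B r ->
  has [in nth set0 B t] (u :: q).
Proof.
case=> _ edgeB contB + + rB.
elim: q u s => [|v q IH] u s /=.
  by move=> _ str us ur; rewrite orbF; apply: contB str rB us ur.
case/andP=> uv vq /andP[st tr] us qr.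
have [X /(nthP set0)[k kB <-] /andP[uk vk]] := edgeB _ _ uv.
have [kt | tk] := leqP k t.
  by apply/orP; right; apply: (IH v k) => //; rewrite kt.
by apply/orP; left; apply: contB kB us uk; rewrite st ltnW.
Qed.

Lemma pathwidth_leq (T : finType) (e : rel T) (p : nat) :
  pathwidth e <= p ->
  exists B, path_decomposition e B /\ {in B, forall X : {set T}, #|X| <= p.+1}.
Proof.
rewrite /pathwidth; case: ex_minnP => w /boolp.asboolP[B decB <-] _ Bp.
exists B; split=> // X XB.
have le := @leq_bigmax_seq _ B xpredT (fun X : {set T} => #|X|) X XB isT.
by apply: (leq_trans le); apply: leq_trans (leqSpred _) _.
Qed.

Lemma semi_ladder_path_avoids (T : finType) (e : rel T) (d l : nat)
    (a b : 'I_l -> T) (S : {set T}) (i j : 'I_l) :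
  semi_ladder e d a b -> i < j ->
  {in S, forall x, capped_dist e d x (a i) = capped_dist e d x (a j)} ->
  exists p, [/\ path e (b i) p, last (b i) p = a j, size p <= d &
                {in b i :: p, forall x, x \notin S}].
Proof.
move=> [_ [near far]] ij eqS.
have /at_most_distP[p [bp pa pd]] := near i j ij.
exists p; split=> // x xp; apply/negP=> xS; case/negP: (far i).
case/splitPl: xp bp pa pd => p1 p2 p1x.
rewrite cat_path last_cat size_cat p1x => /andP[bp1 xp2] p2a pd.
have p2d : size p2 <= d := leq_trans (leq_addl _ _) pd.
(* The tail [p2] has length at most [d], where the cap loses nothing, so equal labels at [x] yield a
   path from [x] to [a i] that is no longer. *)
have : at_most (dist e x (a j)) (size p2) by apply/at_most_distP; exists p2.
rewrite (@at_most_capped_dist _ e d) -?eqS -?at_most_capped_dist //.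
case/at_most_distP=> p3 [xp3 p3a p32]; apply/at_most_distP; exists (p1 ++ p3).
rewrite cat_path last_cat size_cat bp1 p1x; split=> //.
by apply: leq_trans pd; rewrite leq_add2l.
Qed.

Theorem theorem6p11 (p d : nat) (hp : 1 <= p) (hd : 1 <= d)
    (T : finType) (e : rel T) (e_sym : symmetric e) (e_irr : irreflexive e) :
  pathwidth e <= p ->
  ~ contains_semi_ladder e d
      ((2 * d + 3) * (p + 1)`! * ((2 * d + 3) * (d + 2)) ^ (p + 1)).
Proof.
move=> /pathwidth_leq[B [decB Bp]]; set l := _ * _ => -[a [b ladder]].
have [coverB _ _] := decB.
pose t i := find (fun X : {set T} => a i \in X) B.
have hasB i : has (fun X : {set T} => a i \in X) B.
  by have [X XB aX] := coverB (a i); apply/hasP; exists X.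
have tB i : t i < size B by rewrite -has_find.
pose A i := nth set0 B (t i).
have aA i : a i \in A i := nth_find set0 (hasB i).
have L0 : 0 < #|'I_d.+2| by rewrite card_ord.
have m0 : 0 < 2 * d + 3 by rewrite addn3.
(* With an empty initial core, bags of size at most [p + 1] and [d + 2] labels, the sunflower
   threshold is exactly [l]. *)
have [i _|i j _ _ x| |J [S [_ cardJ Jdisj JS]]] :=
  @labelled_sunflower _ _ 'I_d.+2 A (fun i x => capped_dist e d x (a i))
    (2 * d + 3) (p + 1) set0 [set: 'I_l] L0 m0.
- by rewrite setD0 addn1 Bp // mem_nth.
- by rewrite inE.
- by rewrite cardsT !card_ord -(addn2 d) /l.
have [i1 i1J] : exists i, i \in J by apply/card_gt0P; lia.
have [i0 i0J i0min] := @arg_minnP _ i1 [in J] val i1J.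
pose D := J :\ i0.
have cardD : 2 * d + 2 <= #|D| by move: cardJ; rewrite (cardsD1 i0) i0J -/D; lia.
have DJ j : j \in D -> j \in J by rewrite inE => /andP[].
have reach j : j \in D -> exists q, [/\ path e (b i0) q, last (b i0) q = a j,
    size q <= d & {in b i0 :: q, forall x, x \notin S}].
  move=> jD; apply: semi_ladder_path_avoids ladder _ _ => [|x xS].
    have := i0min j (DJ j jD); rewrite leq_eqVlt => /orP[/eqP/val_inj i0j|//].
    by move: jD; rewrite !inE i0j eqxx.
  by apply: JS => //; apply: DJ.
have [j1 j1D] : exists j, j \in D by apply/card_gt0P; lia.
(* While [i0] is least as a ladder index, [jl] and [jr] are extremal for the bag position [t]. *)
have [jl jlD jlmin] := @arg_minnP _ j1 [in D] t j1D.
have [jr jrD jrmax] := @arg_maxnP _ j1 [in D] t j1D.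
have [pl [bpl pla pld plS]] := reach jl jlD.
have [pr [bpr pra prd prS]] := reach jr jrD.
(* The walk goes from [a jl] back to [b i0] and on to [a jr]; [belast] drops [a jl], the starting
   vertex of the joined walk. *)
pose q := rev (belast (b i0) pl) ++ pr.
have catq : a jl :: q = rev (b i0 :: pl) ++ pr.
  by rewrite [b i0 :: pl]lastI rev_rcons pla.
have last_rev : last (a jl) (rev (belast (b i0) pl)) = b i0.
  by case: (pl) pla => [|x s] //= _; rewrite rev_cons last_rcons.
have qpath : path e (a jl) q.
  rewrite cat_path last_rev bpr andbT -pla rev_path.
  by rewrite (eq_path (e' := e)) // => x y; apply: e_sym.
have qa : last (a jl) q = a jr by rewrite last_cat last_rev.
have qS x : x \in a jl :: q -> x \notin S.
  rewrite catq mem_cat mem_rev => /orP[/plS //|xpr].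
  by apply: prS; rewrite inE xpr orbT.
(* At most [d + 1] vertices come from [b i0 :: pl] and [d] from [pr], the shared [b i0] being
   counted once. *)
have sizeq : size (a jl :: q) <= 2 * d + 1.
  by rewrite catq size_cat size_rev /=; lia.
pose hit j := nth (a jl) (a jl :: q) (find [in A j] (a jl :: q)).
have meet j : j \in D -> has [in A j] (a jl :: q).
  move=> jD; apply: (path_meets_bag decB qpath _ (tB jr) (aA jl)).
    by rewrite jlmin //; apply: jrmax.
  by rewrite qa; apply: aA.
have hitA j : j \in D -> hit j \in A j by move/meet/(nth_find (a jl)).
have hitq j : j \in D -> hit j \in a jl :: q.
  by move/meet; rewrite has_find; apply: mem_nth.
(* A vertex common to two of these bags lies in [S], which the walk avoids. *)
have hit_inj : {in D &, injective hit}.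
  move=> i j iD jD eqhit; apply/eqP; case: eqVneq => // ij.
  case/negP: (qS _ (hitq i iD)).
  have /subsetP := Jdisj i j (DJ i iD) (DJ j jD) ij; apply.
  by rewrite inE hitA // eqhit hitA.
have : size [seq hit j | j <- enum D] <= size (a jl :: q).
  apply: uniq_leq_size => [|x /mapP[j]].
    rewrite map_inj_in_uniq ?enum_uniq // => i j.
    by rewrite !mem_enum; apply: hit_inj.
  by rewrite mem_enum => jD ->; apply: hitq.
rewrite size_map -cardE => cardW.
have := leq_trans cardD (leq_trans cardW sizeq); lia.
Qed.
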